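(* Let $n\ge 1$ and $s$ be integers with $2\le s\le n+1$, and let $\mathcal{F}\subseteq 2^{[n]}$ be an $s$-saturated family. Then $$|\mathcal{F}|\;\ge\;\left(1-\frac1s\right)\cdot 2^{n}+\left(\frac{2^{s-1}}{s}-1\right)\cdot 2^{g(n,s)},$$ where $$g(n,s):=\max\left\{t\in\{0,1,\dots,n\}:\ \sum_{i=0}^{t}\binom{n}{i}\le\frac{2^{n}-(2^{s-1}-s)\,2^{t}}{s}\right\}.$$
   Context: $[n]=\{1,\dots,n\}$ and $2^{[n]}$ is the set of all subsets of $[n]$. A matching of size $s$ in a family $\mathcal{F}\subseteq 2^{[n]}$ is a choice of $A_1,\dots,A_s\in\mathcal{F}$ with $A_i\cap A_j=\emptyset$ for all $i\ne j$ (the sets are not required to be distinct; thus $\emptyset$ counts as disjoint from itself, and a family containing $\emptyset$ contains a matching of size $s$). A family $\mathcal{F}\subseteq 2^{[n]}$ is $s$-saturated if it contains no matching of size $s$, and for every $A\in 2^{[n]}\setminus\mathcal{F}$ the family $\mathcal{F}\cup\{A\}$ contains a matching of size $s$. *)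

(* Defs.v *)
From mathcomp Require Import all_boot all_order all_algebra.

Set Implicit Arguments.
Unset Strict Implicit.
Unset Printing Implicit Defensive.

Import Order.TTheory GRing.Theory Num.Theory.

(* The ground set [n] is encoded as 'I_n.  The members of a matching need not
   be distinct: the empty set is disjoint from itself, so it may be repeated. *)
Definition has_matching (n s : nat) (F : {set {set 'I_n}}) : Prop :=
  exists A : 'I_s -> {set 'I_n},
    (forall i, A i \in F) /\
    (forall i j, i != j -> [disjoint A i & A j]).

Definition saturated (n s : nat) (F : {set {set 'I_n}}) : Prop :=
  ~ has_matching s F /\
  (forall A : {set 'I_n}, A \notin F -> has_matching s (A |: F)).

Local Open Scope ring_scope.

Definition g_cond (n s t : nat) : bool :=
  (\sum_(0 <= i < t.+1) 'C(n, i)%:R : rat)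
    <= (2 ^+ n - (2 ^+ (s - 1)%N - s%:R) * 2 ^+ t) / s%:R.

(* \max over an empty range is 0, but this default is never used when
   2 <= s <= n + 1, since then g_cond n s 0 holds. *)
Definition g (n s : nat) : nat := (\max_(t < n.+1 | g_cond n s t) t)%N.

(* Main.v *)
(* Let m = s - 1, let nu X be the largest number of pairwise disjoint members of
   F inside X, and let D be the complement of F.  Saturation gives nu = 0 exactly
   on D, and each layer L_k = {X | nu X = k}, 0 <= k <= m, has at least |D| sets:
   L_k order-shatters exactly |L_k| sets, and it shatters every Y in D strongly,
   since ~Y contains m disjoint members and adding k of them to any subset of Y
   gives a set in L_k.
   Now let Y be in D, let B_1, ..., B_m be disjoint members of F inside ~Y and let
   C be the complement of their union, so that Y is contained in C.  On top of D,
   L_k order-shatters 2^|C| ('C(m, k) - 1) members of F, namely the sets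
   U :|: B_i :|: {b_j | j in J} with U in C, b_j a fixed point of B_j, i the first
   element of J, and J a nonempty set order-shattered by the k-subsets of an m-set.  Summing over k,
     s |D| + (2^m - s) 2^|Y| <= 2^n   for every Y in D,
   which is the theorem if D has a set of size at least g n s; otherwise |D| is at
   most a partial sum of binomials, which the definition of g bounds. *)
Require Import Defs.
From mathcomp Require Import all_boot all_order all_algebra.
From mathcomp Require Import zify ring.

Set Implicit Arguments.
Unset Strict Implicit.
Unset Printing Implicit Defensive.

Import Order.TTheory GRing.Theory Num.Theory.

(** * Order-shattering *)

Section Forcing.
Context {T : finType}.
Implicit Types (Q : pred {set T}) (l : seq T) (e : T) (P X Y Z : {set T}).

(* Game semantics of order-shattering: the coordinates in [l] are decided one by
   one, by an adversary if they lie in [X] and by the player otherwise; the player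
   wants the resulting set to satisfy [Q].  [P] collects the elements taken so far. *)
Fixpoint forces Q l P X : bool :=
  if l is e :: l' then
    if e \in X then forces Q l' P X && forces Q l' (e |: P) X
    else forces Q l' P X || forces Q l' (e |: P) X
  else Q P.

Lemma eq_forces Q l P X Y :
  {in l, X =i Y} -> forces Q l P X = forces Q l P Y.
Proof.
elim: l P => //= e l IH P XY.
have XYl : {in l, X =i Y} by move=> x xl; apply: XY; rewrite inE xl orbT.
by rewrite (XY e) ?mem_head // !IH.
Qed.

Lemma sum_powersetU1 e Y (phi : {set T} -> nat) : e \notin Y ->
  \sum_(X in powerset (e |: Y)) phi X =
  \sum_(X in powerset Y) (phi X + phi (e |: X)).
Proof.
move=> eY; rewrite (bigID (fun X => e \in X)) /= addnC big_split /=.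
congr (_ + _).
  apply: eq_bigl => X; rewrite !powersetE.
  apply/andP/idP => [[sXeY eX]|sXY].
    apply/subsetP => x xX; have /setU1P[xe|//] := subsetP sXeY x xX.
    by rewrite xe in xX; rewrite xX in eX.
  split; first exact: subset_trans sXY (subsetUr _ _).
  by apply: contra eY; apply: (subsetP sXY).
rewrite (reindex_onto (fun X => e |: X) (fun X => X :\ e)) /=; last first.
  by move=> X /andP[_ eX]; rewrite setD1K.
apply: eq_bigl => X; rewrite !powersetE setU11 andbT.
apply/andP/idP => [[sXeY /eqP eX]|sXY].
  have eX' : e \notin X by rewrite -eX !inE eqxx.
  apply/subsetP => x xX.
  have /setU1P[xe|//] : x \in e |: Y by apply: (subsetP sXeY); rewrite !inE xX orbT.
  by rewrite -xe xX in eX'.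
split; first exact: setUS.
by rewrite setU1K //; apply: contra eY; apply: (subsetP sXY).
Qed.

(* Order-shattering form of the Sauer-Shelah lemma. *)
Lemma sum_forces Q l P : uniq l ->
  \sum_(X in powerset [set x in l]) forces Q l P X =
  \sum_(Y in powerset [set x in l]) Q (P :|: Y).
Proof.
elim: l P => [|e l IH] P /=.
  move=> _; have -> : [set x in [::]] = set0 :> {set T} by apply/setP => x; rewrite !inE.
  by rewrite powerset0 !big_set1 setU0.
case/andP=> el ul; have -> : [set x in e :: l] = e |: [set x in l] by apply/setP => x; rewrite !inE.
rewrite !sum_powersetU1 ?inE // [RHS]big_split /=.
have -> : \sum_(X in powerset [set x in l]) Q (P :|: (e |: X)) =
          \sum_(X in powerset [set x in l]) Q ((e |: P) :|: X).
  by apply: eq_bigr => X _; rewrite setUCA setUA.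
rewrite -!IH // -big_split /=; apply: eq_bigr => X; rewrite powersetE => sX.
have eX : e \notin X by apply: contra el => /(subsetP sX); rewrite inE.
rewrite (negPf eX) setU11.
have E P' : forces Q l P' (e |: X) = forces Q l P' X.
  apply: eq_forces => x xl; rewrite !inE; case: eqP => // xe.
  by rewrite xe (negPf el) in xl.
(* The pair [X], [e |: X] contributes the disjunction and the conjunction of the same two booleans,
   and these add up to the sum of the two. *)
by rewrite !E; case: forces; case: forces.
Qed.

Lemma card_forces Q l : uniq l -> (forall x, x \in l) ->
  #|[set X | forces Q l set0 X]| = #|[set Y | Q Y]|.
Proof.
move=> ul lT; have sT : [set x in l] = setT by apply/setP => x; rewrite !inE lT.
have sumE (q : pred {set T}) : \sum_(X in powerset setT) (q X : nat) = #|[set X | q X]|.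
  rewrite powersetT -sum1dep_card big_mkcond [RHS]big_mkcond /=.
  by apply: eq_bigr => X _; rewrite inE; case: (q X).
have := sum_forces Q set0 ul; rewrite sT sumE => ->; rewrite -sumE.
by apply: eq_bigr => X _; rewrite set0U.
Qed.

(** Along [l1] the player takes exactly the elements of [Z], whatever the adversary does; [Y] is
    what the adversary has taken there. *)
Lemma forces_cat Q l1 l2 P X Z : [disjoint Z & X] ->
  (forall Y, Y \subset X :&: [set x in l1] ->
     forces Q l2 (P :|: (Z :&: [set x in l1]) :|: Y) X) ->
  forces Q (l1 ++ l2) P X.
Proof.
move=> dZX; elim: l1 P => [|e l IH] P H /=.
  have := H set0; rewrite sub0set => /(_ isT); rewrite setU0 (_ : Z :&: _ = set0) ?setU0 //.
  by apply/setP => x; rewrite !inE andbF.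
have [eX|eX] := boolP (e \in X).
  have eZ : e \notin Z by apply: contraL eX => /(disjointFr dZX) ->.
  have E : Z :&: [set x in e :: l] = Z :&: [set x in l].
    by apply/setP => x; rewrite !inE; case: eqP => // ->; rewrite (negPf eZ).
  apply/andP; split; apply: IH => Y sY.
    rewrite -E; apply: H; apply: (subset_trans sY).
    by apply/subsetP => x; rewrite !inE => /andP[-> ->]; rewrite orbT.
  have := H (e |: Y); rewrite E.
  rewrite (_ : _ :|: (e |: Y) = (e |: P) :|: (Z :&: [set x in l]) :|: Y); last first.
    by rewrite setUCA !setUA.
  apply; apply/subsetP => x /setU1P[->|/(subsetP sY)]; first by rewrite !inE eX eqxx.
  by rewrite !inE => /andP[-> ->]; rewrite orbT.
have sub Y : Y \subset X :&: [set x in l] -> Y \subset X :&: [set x in e :: l].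
  by move=> sY; apply: (subset_trans sY); apply/subsetP => x; rewrite !inE => /andP[-> ->]; rewrite orbT.
have [eZ|eZ] := boolP (e \in Z).
  apply/orP; right; apply: IH => Y /sub /H.
  rewrite (_ : P :|: _ = (e |: P) :|: (Z :&: [set x in l])) //.
  by apply/setP => x; rewrite !inE; case: eqP => //= ->; rewrite eZ !orbT.
apply/orP; left; apply: IH => Y /sub /H.
rewrite (_ : Z :&: [set x in e :: l] = Z :&: [set x in l]) //.
by apply/setP => x; rewrite !inE; case: eqP => //= ->; rewrite (negPf eZ).
Qed.

(** * Reaching a prescribed value of a monotone function with unit increments *)

Section Strategy.
Variable f : {set T} -> nat.
Hypothesis f_mono : forall X Y, X \subset Y -> f X <= f Y.
Hypothesis f_lip : forall e X, f (e |: X) <= (f X).+1.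

(* Whenever the player moves, the best case for the player's later moves is worth at
   least the worst case of the adversary's; this prevents a move from
   being wrong both ways in [forces_dominates]. *)
Fixpoint dominates X l : Prop :=
  if l is e :: l' then
    dominates X l' /\
    (e \notin X -> forall P, [disjoint P & [set x in l']] ->
       f (P :|: ([set x in l'] :&: X)) <= f (P :|: ([set x in l'] :\: X)))
  else True.

(** The outer bounds are the values of [f] when only the adversary, or only the player, takes all
    that is left. The player keeps [k] between them, and at the end of the list they coincide. *)
Lemma forces_dominates k l P X : uniq l -> [disjoint P & [set x in l]] ->
  dominates X l ->
  f (P :|: ([set x in l] :&: X)) <= k <= f (P :|: ([set x in l] :\: X)) ->
  forces [pred Y | f Y == k] l P X.
Proof.
elim: l P => [|e l IH] P /=.
  move=> _ _ _; rewrite (_ : [set x in [::]] = set0); last by apply/setP => x; rewrite !inE.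
  by rewrite set0I set0D setU0 eqn_leq.
case/andP=> el ul dP [dom domE] /andP[up lo].
have dP' : [disjoint P & [set x in l]].
  by apply: disjointWr dP; apply/subsetP => x; rewrite !inE => ->; rewrite orbT.
have deP : [disjoint e |: P & [set x in l]].
  rewrite -setI_eq0; apply/eqP/setP => x; rewrite !inE.
  case: eqP => [->|_] /=; first by rewrite (negPf el).
  by apply/negP => /andP[xP xl]; have := disjointFr dP' xP; rewrite inE xl.
have Es : [set x in e :: l] = e |: [set x in l] by apply/setP => x; rewrite !inE.
rewrite Es in up lo.
have [eX|eX] := boolP (e \in X).
  have E1 : (e |: [set x in l]) :&: X = e |: ([set x in l] :&: X).
    by apply/setP => x; rewrite !inE; case: eqP => [->|].
  have E2 : (e |: [set x in l]) :\: X = [set x in l] :\: X.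
    by apply/setP => x; rewrite !inE; case: eqP => [->|] //=; rewrite eX.
  rewrite E1 in up; rewrite E2 in lo.
  apply/andP; split; apply: IH => //; apply/andP; split.
  - by apply: leq_trans up; apply: f_mono; rewrite setUS // subsetUr.
  - by [].
  - by rewrite -setUA setUCA.
  - by apply: leq_trans lo _; apply: f_mono; rewrite -setUA subsetUr.
have E1 : (e |: [set x in l]) :&: X = [set x in l] :&: X.
  by apply/setP => x; rewrite !inE; case: eqP => [->|] //=; rewrite (negPf eX) andbF.
have E2 : (e |: [set x in l]) :\: X = e |: ([set x in l] :\: X).
  by apply/setP => x; rewrite !inE; case: eqP => [->|] //=; rewrite (negPf eX).
rewrite E1 in up; rewrite E2 in lo.
(* The player skips [e] as long as the upper bound stays at least [k]. Otherwise it would drop below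
   [k]; [domE] puts the lower bound no higher, so taking [e] lifts the lower bound to at most
   [k]. *)
have [lo'|lo'] := leqP k (f (P :|: ([set x in l] :\: X))).
  by apply/orP; left; apply: IH => //; rewrite up lo'.
apply/orP; right; apply: IH => //; apply/andP; split; last by rewrite -setUA setUCA.
rewrite -setUA; apply: leq_trans (f_lip _ _) _.
exact: leq_ltn_trans (domE eX P dP') lo'.
Qed.

End Strategy.
End Forcing.

(** * Sets order-shattered by the subsets of a fixed size *)

Section Ballot.
Context {I : finType}.
Implicit Types (l : seq I) (J P : {set I}).

(* Every suffix of [l] that starts in [J] has at most half of its elements in [J]. *)
Fixpoint ballot l J : bool :=
  if l is e :: l' then
    ballot l' J && ((e \in J) ==> (2 * count (mem J) l <= size l))
  else true.

Lemma ballot_count l J : ballot l J -> 2 * count (mem J) l <= size l.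
Proof.
elim: l => //= e l IH /andP[/IH le2]; have [eJ|eJ] /= := boolP (e \in J) => //.
by rewrite add0n => _; lia.
Qed.

Lemma ballot_cat l1 l2 J : ballot (l1 ++ l2) J -> ballot l2 J.
Proof. by elim: l1 => //= e l1 IH /andP[/IH]. Qed.

(** The two inequalities express that the player survives an adversary who takes all remaining
    elements of [J], or none of them. *)
Lemma forces_slice_ballot k l P J : uniq l -> [disjoint P & [set x in l]] ->
  forces [pred Y : {set I} | #|Y| == k] l P J ->
  [&& ballot l J, count (mem J) l + #|P| <= k & count (mem J) l + k <= #|P| + size l].
Proof.
elim: l P => [|e l IH] P /=; first by move=> _ _ /eqP->; rewrite !add0n addn0 leqnn.
case/andP=> el ul dP.
have dP' : [disjoint P & [set x in l]].
  by apply: disjointWr dP; apply/subsetP => x; rewrite !inE => ->; rewrite orbT.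
have eP : e \notin P by apply: contraL dP => eP; apply/pred0Pn; exists e; rewrite /= !inE eP eqxx.
have deP : [disjoint e |: P & [set x in l]].
  rewrite -setI_eq0; apply/eqP/setP => x; rewrite !inE.
  case: eqP => [->|_] /=; first by rewrite (negPf el).
  by apply/negP => /andP[xP xl]; have := disjointFr dP' xP; rewrite inE xl.
have cP : #|e |: P| = #|P|.+1 by rewrite cardsU1 eP.
have [eJ|eJ] := boolP (e \in J).
  (* Refusing [e] gives [h2] and taking it gives [h1]; in their sum [k] and [#|P|] cancel, which
     leaves the ballot condition at [e]. *)
  by case/andP=> /(IH _ ul dP')/and3P[-> _ h2] /(IH _ ul deP)/and3P[_ h1 _] /=; rewrite cP in h1; lia.
by case/orP=> [/(IH _ ul dP')|/(IH _ ul deP)] /and3P[-> h1 h2] /=; rewrite ?cP in h1 h2; lia.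
Qed.

Lemma card_ballot k :
  'C(#|I|, k) <= #|[set J | [&& ballot (enum I) J, count (mem J) (enum I) <= k
                              & count (mem J) (enum I) + k <= #|I|]]|.
Proof.
have := card_forces [pred Y : {set I} | #|Y| == k] (enum_uniq I) (@mem_enum _ _).
rewrite card_draws => <-; apply/subset_leq_card/subsetP => J; rewrite !inE.
move/(forces_slice_ballot (enum_uniq I)); rewrite cards0 addn0 add0n -cardE.
by apply; rewrite -setI_eq0 set0I.
Qed.

End Ballot.

(** * Matching numbers *)

Section Packing.
Context {T : finType}.
Variable F : {set {set T}}.
Implicit Types (X Y Z K : {set T}) (r a b : nat).

(** Removing [K = set0] leaves [X] unchanged, so the empty set may be repeated here just as in
    [has_matching]. *)
Fixpoint packs r X : bool :=
  if r is r'.+1 then [exists K, [&& K \in F, K \subset X & packs r' (X :\: K)]]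
  else true.

Lemma packs_mono r X Y : X \subset Y -> packs r X -> packs r Y.
Proof.
elim: r X Y => //= r IH X Y sXY /existsP[K /and3P[KF sKX pK]].
by apply/existsP; exists K; rewrite KF (subset_trans sKX) //= (IH _ _ _ pK) // setSD.
Qed.

Lemma packs_pred r X : packs r.+1 X -> packs r X.
Proof.
elim: r X => // r IH X /existsP[K /and3P[KF sKX pK]].
by apply/existsP; exists K; rewrite KF sKX; apply: IH.
Qed.

Lemma packs_leq a r X : a <= r -> packs r X -> packs a X.
Proof. by move/subnK<-; elim: (r - a) => // d IH; rewrite addSn => /packs_pred. Qed.

Lemma packs_add a b X Y : [disjoint X & Y] ->
  packs a X -> packs b Y -> packs (a + b) (X :|: Y).
Proof.
elim: a X => [|a IH] X dXY /=.
  by move=> _; apply: packs_mono (subsetUr _ _).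
case/existsP=> K /and3P[KF sKX pK] pY; apply/existsP; exists K.
rewrite KF (subset_trans sKX (subsetUl _ _)) /=.
have dKY : [disjoint K & Y] := disjointWl sKX dXY.
have /setDidPl YK : [disjoint Y & K] by rewrite disjoint_sym.
rewrite setDUl YK.
by apply: IH => //; apply: disjointWl dXY; apply: subsetDl.
Qed.

Lemma packs_split a b X : packs (a + b) X ->
  exists Z, [/\ Z \subset X, packs a Z & packs b (X :\: Z)].
Proof.
elim: a X => [|a IH] X /=; first by exists set0; rewrite sub0set setD0.
case/existsP=> K /and3P[KF sKX /IH[Z [sZ pZ pXZ]]].
exists (K :|: Z); split.
- by rewrite subUset sKX (subset_trans sZ) // subsetDl.
- apply/existsP; exists K; rewrite KF subsetUl /=; apply: packs_mono pZ.
  rewrite setDUl setDv set0U; apply/subsetP => x xZ; rewrite !inE xZ andbT.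
  by have := subsetP sZ x xZ; rewrite inE => /andP[].
- by rewrite -setDDl.
Qed.

(** Among disjoint members at most one contains [e], so dropping one suffices. *)
Lemma packs_rem r e X : packs r.+1 (e |: X) -> packs r X.
Proof.
elim: r X => // r IH X /existsP[K /and3P[KF sK pK]].
have [eK|eK] := boolP (e \in K).
  apply: (@packs_mono r.+1 _ _ _ pK); apply/subsetP => x; rewrite !inE => /andP[xK /orP[/eqP xe|//]].
  by rewrite xe eK in xK.
apply/existsP; exists K; rewrite KF /=; apply/andP; split.
  apply/subsetP => x xK; have /setU1P[xe|//] := subsetP sK x xK.
  by rewrite -xe xK in eK.
apply: IH; apply: (@packs_mono r.+1 _ _ _ pK); apply/subsetP => x; rewrite !inE.
by case: eqP => //= _; rewrite orbF.
Qed.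

Lemma packs_family r (B : 'I_r -> {set T}) X :
  (forall i, B i \in F /\ B i \subset X) ->
  (forall i j, i != j -> [disjoint B i & B j]) -> packs r X.
Proof.
elim: r B X => //= r IH B X hB dB; apply/existsP; exists (B ord0).
have [-> ->] := hB ord0; apply: (IH (fun i => B (lift ord0 i))) => [i|i j ij].
  have [-> sB] := hB (lift ord0 i); split=> //.
  by rewrite subsetD sB dB // eq_sym neq_lift.
by apply: dB; rewrite (inj_eq lift_inj).
Qed.

Lemma packs_blocks r X : packs r X -> exists B : 'I_r -> {set T},
  (forall i, B i \in F /\ B i \subset X) /\
  (forall i j, i != j -> [disjoint B i & B j]).
Proof.
elim: r X => [|r IH] X /=; first by exists (fun=> set0); split=> [[]|[]].
case/existsP=> K /and3P[KF sKX /IH[B [hB dB]]].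
exists (fun i => if unlift ord0 i is Some j then B j else K).
have BK j : [disjoint B j & K] by have [_] := hB j; rewrite subsetD => /andP[].
split=> [i|i j].
  case: unliftP => [j _|_] //; have [-> ] := hB j.
  by rewrite subsetD => /andP[].
case: unliftP => [i' ->|->]; case: unliftP => [j' ->|->] //; rewrite ?eqxx //.
- by move=> ij; apply: dB; apply: contraNN ij => /eqP->.
- by rewrite disjoint_sym.
Qed.

End Packing.

(** * The matching number inside a set, for an up-closed saturated family *)

Section MatchingNumber.
Context {T : finType}.
Variables (F : {set {set T}}) (m : nat).
Implicit Types (X Y Z P U : {set T}).
Hypothesis F_up : forall X Y, X \in F -> X \subset Y -> Y \in F.
Hypothesis F_free : ~~ packs F m.+1 setT.
Hypothesis F_sat : forall X, X \notin F -> packs F m (~: X).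

Definition nu X : nat := \max_(r < m.+1 | packs F r X) r.

Lemma packs_nu X : packs F (nu X) X.
Proof.
by apply: (big_ind (fun r => packs F r X)) => // a b pa pb; rewrite /maxn; case: ifP.
Qed.

(** The cap [r < m.+1] in [nu] loses no packing, because [F_free] rules out [m.+1] disjoint
    members. *)
Lemma leq_nuE r X : (r <= nu X) = packs F r X.
Proof.
apply/idP/idP => [le_r|pr]; first exact: packs_leq le_r (packs_nu X).
have rm : r < m.+1.
  rewrite ltnNge; apply: contra F_free => mr.
  exact: packs_leq mr (packs_mono (subsetT _) pr).
exact: (@leq_bigmax_cond _ _ (fun i : 'I_m.+1 => i : nat) (Ordinal rm)).
Qed.

Lemma nu_leq X : nu X <= m.
Proof. by apply/bigmax_leqP => i _; rewrite -ltnS. Qed.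

Lemma nu_mono X Y : X \subset Y -> nu X <= nu Y.
Proof. by move=> sXY; rewrite leq_nuE; apply: packs_mono sXY (packs_nu X). Qed.

Lemma nu_setU1 e X : nu (e |: X) <= (nu X).+1.
Proof.
case E: (nu (e |: X)) => [//|r]; rewrite ltnS leq_nuE.
by apply: (@packs_rem _ _ _ e); rewrite -E packs_nu.
Qed.

Lemma nu_setU_seq P (s : seq T) : nu (P :|: [set x in s]) <= nu P + size s.
Proof.
elim: s => [|e s IH] /=.
  by rewrite addn0 (_ : [set x in [::]] = set0) ?setU0 //; apply/setP => x; rewrite !inE.
rewrite (_ : [set x in e :: s] = e |: [set x in s]); last by apply/setP => x; rewrite !inE.
by rewrite setUCA addnS (leq_trans (nu_setU1 _ _)).
Qed.

Lemma nu_setU X Y : [disjoint X & Y] -> nu X + nu Y <= nu (X :|: Y).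
Proof. by move=> dXY; rewrite leq_nuE; apply: packs_add; rewrite ?packs_nu. Qed.

(** This turns disjoint members found outside [X] into an upper bound on [nu X]. *)
Lemma nu_setC X : nu X + nu (~: X) <= m.
Proof.
apply: leq_trans (nu_setU _) (nu_leq _).
by rewrite -setI_eq0 setICr.
Qed.

Lemma nu_gt0 X : (0 < nu X) = (X \in F).
Proof.
rewrite leq_nuE /=; apply/existsP/idP => [[K /and3P[KF sKX _]]|XF]; first exact: F_up sKX.
by exists X; rewrite XF subxx.
Qed.

(** By [F_sat], [~: Y] splits into [Z], packing [k] members, and a rest packing [m - k]. The player
    takes exactly [Z]; whatever part [V] of [Y] the adversary adds, the rest stays outside, so
    [nu_setC] gives [nu (Z :|: V) <= k]. *)
Lemma forces_nonmember l k Y : uniq l -> (forall x, x \in l) -> k <= m ->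
  Y \notin F -> forces [pred X | nu X == k] l set0 Y.
Proof.
move=> ul lT km /F_sat; rewrite -(subnKC km) => /packs_split[Z [sZ pZ pZ']].
rewrite -[l]cats0; apply: (@forces_cat _ _ _ _ _ _ Z).
  by rewrite disjoints_subset.
have -> : [set x in l] = setT by apply/setP => x; rewrite !inE lT.
rewrite set0U !setIT => V sV /=; apply/eqP/anti_leq/andP; split; last first.
  by rewrite leq_nuE; apply: packs_mono pZ; apply: subsetUl.
have pC : m - k <= nu (~: (Z :|: V)).
  rewrite leq_nuE; apply: packs_mono pZ'.
  rewrite setCU setDE setIC; apply: setIS; rewrite setCS; exact: sV.
by have := nu_setC (Z :|: V); lia.
Qed.

(** * Order-shattered members built from [m] disjoint blocks *)

Section Blocks.
Variables (B : 'I_m -> {set T}) (b : 'I_m -> T).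
Hypothesis B_F : forall i, B i \in F.
Hypothesis B_disj : forall i j, i != j -> [disjoint B i & B j].
Hypothesis b_B : forall i, b i \in B i.

(** Coordinates are decided block by block, so that the ballot condition on block indices controls
    the game on points. *)
Definition flat (s : seq 'I_m) : seq T := flatten [seq enum (B j) | j <- s].
Definition W s : {set T} := [set x in flat s].
Definition core : {set T} := ~: W (enum 'I_m).

Lemma mem_W s x : reflect (exists2 j, j \in s & x \in B j) (x \in W s).
Proof.
rewrite inE; apply: (iffP flatten_mapP) => [[j js]|[j js xj]].
  by rewrite mem_enum; exists j.
by exists j; rewrite ?mem_enum.
Qed.

Lemma sub_W s1 s2 : {subset s1 <= s2} -> W s1 \subset W s2.
Proof. by move=> s12; apply/subsetP => x /mem_W[j /s12 js xj]; apply/mem_W; exists j. Qed.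

Lemma B_inj x i j : x \in B i -> x \in B j -> i = j.
Proof.
move=> xi xj; apply/eqP; apply: contraTT xj => /B_disj dij.
by rewrite (disjointFr dij xi).
Qed.

Lemma nu_W_ge P s : uniq s -> (forall j, j \in s -> [disjoint P & B j]) ->
  nu P + size s <= nu (P :|: W s).
Proof.
elim: s => [|j s IH] /=; first by move=> _ _; rewrite addn0 nu_mono ?subsetUl.
case/andP=> js us dP.
have -> : P :|: W (j :: s) = (P :|: W s) :|: B j.
  by apply/setP => x; rewrite !inE mem_cat mem_enum -orbA; congr (_ || _); rewrite orbC.
apply: leq_trans (nu_setU _); last first.
  rewrite -setI_eq0 setIUl setU_eq0 setI_eq0 dP ?mem_head //=.
  apply/eqP/setP => x; rewrite inE in_set0; apply/andP => -[/mem_W[i si xi] xj].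
  by rewrite -(B_inj xi xj) si in js.
have nuB : 0 < nu (B j) by rewrite nu_gt0.
have := IH us (fun i si => dP i (mem_behead (s := j :: s) si)).
by move=> IHs; rewrite addnS -addn1 leq_add.
Qed.

(** The blocks with index outside [s], at least [m - size s] in number, lie in the complement, and
    [nu_setC] applies. *)
Lemma nu_W_le U s : uniq s -> U \subset core -> nu (U :|: W s) <= size s.
Proof.
move=> us sU; set s' := [seq j <- enum 'I_m | j \notin s].
have us' : uniq s' by rewrite filter_uniq ?enum_uniq.
have sz : m <= size s + size s'.
  rewrite -{1}(size_enum_ord m) -[leqLHS](count_predC (mem s)) leq_add //.
    rewrite -size_filter; apply: uniq_leq_size; first by rewrite filter_uniq ?enum_uniq.
    by move=> j; rewrite mem_filter => /andP[].
  by rewrite size_filter; apply: sub_count.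
have : nu (W s') <= nu (~: (U :|: W s)).
  apply/nu_mono/subsetP => x /mem_W[j]; rewrite mem_filter => /andP[js _] xj.
  rewrite !inE negb_or; apply/andP; split.
    apply: contraL xj => /(subsetP sU); rewrite inE => /negP xW; apply/negP => xj.
    by apply: xW; apply/mem_W; exists j; rewrite ?mem_enum.
  apply/negP => xs; have /mem_W[i si xi] : x \in W s by rewrite inE.
  by rewrite (B_inj xj xi) si in js.
have : nu set0 + size s' <= nu (set0 :|: W s').
  by apply: nu_W_ge => // j _; rewrite -setI_eq0 set0I.
by rewrite set0U; have := nu_setC (U :|: W s); lia.
Qed.

(** The adversary owns one point per block of [J], each worth at most one in [nu]; the player owns
    the blocks outside [J] entirely, each worth at least one. *)
Lemma dominates_blocks s (J : {set 'I_m}) X : uniq s -> ballot s J ->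
  (forall j x, j \in s -> x \in B j -> (x \in X) = (j \in J) && (x == b j)) ->
  dominates nu X (flat s).
Proof.
elim: s => //= j s IH /andP[js us] /andP[bal jbal] hX.
have dom_s : dominates nu X (flat s).
  by apply: IH => // i x si; apply: hX; rewrite inE si orbT.
(* The block [j] may be partly decided: it still counts for the adversary but no longer for the
   player. The ballot condition at [j] covers this loss. *)
have out_size : count (mem J) (j :: s) <= size [seq i <- s | i \notin J].
  have : count (mem J) s + count (fun i => i \notin J) s = size s := count_predC _ _.
  rewrite size_filter /=.
  have := ballot_count bal; move: jbal; rewrite /=.
  by case: (j \in J) => /=; move: (count (mem J) s) (count _ s) (size s) => c c' d; lia.
have: {subset enum (B j) <= B j} by move=> x; rewrite mem_enum.
rewrite /flat /=; elim: (enum (B j)) => //= e r IHr sub_r.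
split; first by apply: IHr => x xr; apply: sub_r; rewrite inE xr orbT.
move=> _ P dP.
have mem_r x : x \in r ++ flat s -> exists2 i, i \in j :: s & x \in B i.
  rewrite mem_cat => /orP[xr|xs].
    by exists j; rewrite ?mem_head ?sub_r // inE xr orbT.
  have /mem_W[i si xi] : x \in W s by rewrite inE.
  by exists i; rewrite // inE si orbT.
have up : nu (P :|: ([set x in r ++ flat s] :&: X)) <= nu P + count (mem J) (j :: s).
  rewrite -size_filter -(size_map b); apply: leq_trans (nu_setU_seq _ _).
  apply/nu_mono/setUS/subsetP => x; rewrite !inE => /andP[/mem_r[i si xi]].
  rewrite (hX i) // => /andP[iJ /eqP->]; apply: map_f.
  by rewrite mem_filter /= iJ.
apply: leq_trans up _; apply: leq_trans (leq_add (leqnn _) out_size) _.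
have lo : nu P + size [seq i <- s | i \notin J] <= nu (P :|: W [seq i <- s | i \notin J]).
  apply: nu_W_ge; first exact: filter_uniq.
  move=> i; rewrite mem_filter => /andP[_ si]; apply: disjointWr dP.
  apply/subsetP => x xi; rewrite inE mem_cat; apply/orP; right.
  by have : x \in W s by [apply/mem_W; exists i]; rewrite inE.
apply: leq_trans lo _; apply/nu_mono/setUS/subsetP => x /mem_W[i].
rewrite mem_filter => /andP[iJ si] xi; rewrite inE (hX i) ?inE ?si ?orbT //.
rewrite (negPf iJ) /= mem_cat; apply/orP; right.
by have : x \in W s by [apply/mem_W; exists i]; rewrite inE.
Qed.

Lemma flat_uniq s : uniq s -> uniq (flat s).
Proof.
elim: s => //= j s IH /andP[js us]; rewrite /flat /= cat_uniq enum_uniq IH // andbT.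
apply/hasPn => x xs; rewrite mem_enum; apply: contra js => xj.
have /mem_W[i si xi] : x \in W s by rewrite inE.
by rewrite (B_inj xj xi).
Qed.

Lemma core_B x j : x \in core -> x \notin B j.
Proof.
by rewrite inE; apply: contra => xj; apply/mem_W; exists j; rewrite ?mem_enum.
Qed.

Lemma nu_W_size s : uniq s -> size s <= nu (W s).
Proof.
move=> us; rewrite -(set0U (W s)); apply: leq_trans (nu_W_ge us _); first exact: leq_addl.
by move=> j _; rewrite -setI_eq0 set0I.
Qed.

(* The full block [B top] makes this a member of [F]; taking a single point of each
   other block of [J] limits the adversary's influence on [nu], which changes by at
   most one per point. *)
Definition witness (J : {set 'I_m}) : {set T} :=
  (if [seq j <- enum 'I_m | j \in J] is top :: _ then B top else set0) :|:
  [set b j | j in J].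

(** The player follows a fixed plan on the core and the blocks up to the first one in [J], then the
    strategy of [forces_dominates] on the later blocks. *)
Lemma forces_witness k U (J : {set 'I_m}) : k <= m -> U \subset core -> J != set0 ->
  ballot (enum 'I_m) J -> count (mem J) (enum 'I_m) <= k ->
  count (mem J) (enum 'I_m) + k <= m ->
  forces [pred Y | nu Y == k] (enum core ++ flat (enum 'I_m)) set0 (U :|: witness J).
Proof.
move=> km sU J0 bal cJk ckm; rewrite /witness.
have hasJ : has (mem J) (enum 'I_m).
  by have /set0Pn[j jJ] := J0; apply/hasP; exists j; rewrite ?mem_enum.
have ue : uniq (enum 'I_m) := enum_uniq _.
have se : size (enum 'I_m) = m := size_enum_ord m.
set X := U :|: _.
move: (se) (ue) (bal) (cJk) (ckm) (erefl X) (mem_enum 'I_m); rewrite {1}/X.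
(* [top] is the first index in [J], whose whole block lies in the witness; the blocks of [s1] avoid
   [X], so the player may take them whole. *)
case/split_find: hasJ => top s1 s2 topJ s1J {bal cJk ckm se ue}; rewrite cat_rcons.
have notJ j : j \in s1 -> j \notin J by move: s1J; rewrite -all_predC => /allP; apply.
have -> : [seq j <- s1 ++ top :: s2 | j \in J] = top :: [seq j <- s2 | j \in J].
  rewrite filter_cat /=; move: topJ => /= ->.
  by have /eqP -> : [seq j <- s1 | j \in J] == [::] by rewrite -size_eq0 size_filter -leqn0 leqNgt -has_count.
have -> : count (mem J) (s1 ++ top :: s2) = (count (mem J) s2).+1.
  rewrite count_cat /=; move: topJ => /= ->; move: s1J; rewrite has_count -leqNgt leqn0 => /eqP->.
  by [].
move=> sz us bal cJk ckm defX alls.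
have [us1 /hasPn s12 /andP[tops2 us2]] :
    [/\ uniq s1, ~~ has (mem s1) (top :: s2) & uniq (top :: s2)].
  by move: us; rewrite cat_uniq => /and3P[].
have {bal} /=/andP[bal2 btop] := ballot_cat bal.
rewrite -defX => {X defX}; set X := U :|: _.
have hX j x : x \in B j -> (x \in X) = (j == top) || (j \in J) && (x == b j).
  move=> xj; have /negPf xU : x \notin U by apply: contraL xj => /(subsetP sU)/core_B.
  rewrite !inE xU /=.
  congr (_ || _); first by apply/idP/eqP => [/(B_inj xj)|<-].
  apply/imsetP/andP => [[i iJ xi]|[jJ /eqP xj']]; last by exists j.
  by have ji : j = i by [apply: (B_inj xj); rewrite xi b_B]; rewrite ji xi.
have sX : X \subset U :|: W (top :: [seq j <- s2 | j \in J]).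
  apply: setUS; rewrite subUset; apply/andP; split.
    by apply/subsetP => x xt; apply/mem_W; exists top; rewrite ?mem_head.
  apply/subsetP => x /imsetP[j jJ ->]; apply/mem_W; exists j => //.
  have := alls j; rewrite mem_cat => /orP[/notJ|]; first by rewrite jJ.
  by rewrite !inE mem_filter jJ.
(* The player takes [a] early blocks: as many as possible while leaving room below [k] for [top] and
   the later blocks of [J], all of which the adversary may claim. *)
pose a := minn (size s1) (k - (count (mem J) s2).+1).
pose Z := W (take a s1).
pose l1 := enum core ++ flat s1 ++ enum (B top).
have sZ1 x : x \in Z -> exists2 j, j \in s1 & x \in B j.
  by case/mem_W=> j /mem_take js xj; exists j.
have -> : enum core ++ flat (s1 ++ top :: s2) = l1 ++ flat s2.
  by rewrite /l1 /flat map_cat flatten_cat /= !catA.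
have dl1 x : x \in l1 -> x \notin W s2.
  rewrite !mem_cat !mem_enum => xl; apply/negP => /mem_W[i si xi].
  case/or3P: xl => [xc|xs|/(B_inj xi) it].
  - by rewrite (negPf (@core_B x i xc)) in xi.
  - have /mem_W[j sj xj] : x \in W s1 by rewrite inE.
    have is2 : i \in top :: s2 by rewrite inE si orbT.
    by have /negP[] := s12 i is2; rewrite /= (B_inj xi xj).
  - by rewrite -it si in tops2.
apply: (@forces_cat _ _ _ _ _ _ Z).
  rewrite -setI_eq0; apply/eqP/setP => x; rewrite in_setI in_set0; apply/andP => -[/sZ1[j js xj]].
  rewrite (hX _ _ xj) (negPf (notJ j js)) orbF => /eqP jt.
  by have /negP[] := s12 _ (mem_head top s2); rewrite /= -jt.
rewrite set0U => V sV; set P := _ :|: V.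
have sZ : Z \subset P.
  apply/subsetP => x xZ; rewrite in_setU in_setI xZ inE !mem_cat.
  have [j js xj] := sZ1 x xZ.
  have : x \in W s1 by [apply/mem_W; exists j].
  by rewrite inE => ->; rewrite orbT.
have sP : P \subset [set x in l1].
  by rewrite subUset subsetIr (subset_trans sV) // subsetIr.
have sPX : P \subset Z :|: X.
  by rewrite setUSS ?subsetIl // (subset_trans sV) ?subsetIl.
apply: (forces_dominates nu_mono nu_setU1).
- exact: flat_uniq.
- rewrite -setI_eq0; apply/eqP/setP => x; rewrite in_setI in_set0; apply/andP => -[/(subsetP sP)].
  by rewrite inE => /dl1 /negP.
- apply: (@dominates_blocks _ J) => // j x js xj; rewrite (hX _ _ xj); case: eqP => // jt.
  by rewrite -jt js in tops2.
(* Upper side: even with everything in [X] taken, only [a] early blocks, [top] and the later blocks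
   of [J] are met. *)
apply/andP; split.
  have usel : uniq (take a s1 ++ top :: [seq j <- s2 | j \in J]).
    rewrite cat_uniq take_uniq // cons_uniq mem_filter (negPf tops2) andbF filter_uniq // !andbT.
    apply/hasPn => j; rewrite inE mem_filter => jt.
    have /s12 : j \in top :: s2.
      by rewrite inE; case/orP: jt => [->//|/andP[_ ->]]; rewrite orbT.
    by apply: contra => /mem_take.
  have := nu_W_le usel sU; rewrite size_cat /= size_filter size_take_min => le_a.
  apply: (@leq_trans (nu (U :|: W (take a s1 ++ top :: [seq j <- s2 | j \in J])))).
    apply: nu_mono; apply: (@subset_trans _ _ (Z :|: X)).
      by rewrite subUset sPX (subset_trans (subsetIr _ _)) // subsetUr.
    rewrite subUset; apply/andP; split.
      by apply: subset_trans (subsetUr _ _); apply: sub_W => j; rewrite mem_cat => ->.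
    by apply: (subset_trans sX); apply/setUS/sub_W => j; rewrite mem_cat orbC => ->.
  apply: leq_trans le_a _; rewrite -[leqRHS](subnK cJk) leq_add2r.
  exact: leq_trans (geq_minl _ _) (geq_minr _ _).
have usel : uniq (take a s1 ++ [seq j <- s2 | j \notin J]).
  rewrite cat_uniq take_uniq //= filter_uniq // andbT.
  apply/hasPn => j; rewrite mem_filter => /andP[_ j2].
  have /s12 : j \in top :: s2 by rewrite inE j2 orbT.
  by apply: contra => /mem_take.
have := nu_W_size usel; rewrite size_cat size_filter size_take_min => ge_a.
apply: (@leq_trans (nu (W (take a s1 ++ [seq j <- s2 | j \notin J])))).
  apply: leq_trans ge_a.
  (* Both cases of the minimum reach [k]: if [a = size s1] by [ckm], otherwise by the ballot
     condition [btop] at [top]. *)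
  have : count (mem J) s2 + count (fun i => i \notin J) s2 = size s2 := count_predC _ _.
  move: sz btop cJk ckm; rewrite size_cat /= (_ : top \in J) //= /a.
  move: (size s1) (size s2) (count (mem J) s2) (count _ s2) => n1 n2 c c'.
  by clear; lia.
apply/nu_mono/subsetP => x /mem_W[j]; rewrite mem_cat mem_filter => /orP[ja xj|/andP[jJ j2] xj].
  rewrite in_setU; apply/orP; left; apply: (subsetP sZ).
  by apply/mem_W; exists j.
rewrite in_setU in_setD (hX _ _ xj) (negPf jJ) orbF; apply/orP; right; apply/andP; split.
  by apply: contraNneq tops2 => <-.
by apply/mem_W; exists j.
Qed.

Lemma b_witness j (J : {set 'I_m}) : (b j \in witness J) = (j \in J).
Proof.
rewrite !inE; apply/orP/idP => [[]|jJ]; last by right; apply: imset_f.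
  case E: [seq _ <- _ | _] => [|top s]; first by rewrite inE.
  move=> /(B_inj (b_B j)) ->.
  have : top \in [seq i <- enum 'I_m | i \in J] by rewrite E mem_head.
  by rewrite mem_filter => /andP[].
by case/imsetP=> i iJ /(congr1 (fun x => x \in B i)); rewrite b_B => /(B_inj (b_B j)) ->.
Qed.

Lemma witness_core J x : x \in witness J -> x \notin core.
Proof.
move=> xw; suff [j xj] : exists j, x \in B j by apply: contraL xj => /core_B.
move: xw; rewrite inE => /orP[|/imsetP[j _ ->]]; last by exists j.
by case: [seq _ <- _ | _] => [|top _]; [rewrite inE | exists top].
Qed.

Lemma witness_member J : J != set0 -> witness J \in F.
Proof.
case/set0Pn=> j jJ; rewrite /witness.
case E: [seq _ <- _ | _] => [|top s]; last exact: F_up (B_F top) (subsetUl _ _).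
have : j \in [seq i <- enum 'I_m | i \in J] by rewrite mem_filter jJ mem_enum.
by rewrite E.
Qed.

(** The layer order-shatters the nonmembers and the sets [U :|: witness J]; the latter contain a
    full block, hence are members, so the two kinds do not overlap. *)
Lemma card_layer k : k <= m ->
  #|~: F| + ('C(m, k) - 1) * 2 ^ #|core| <= #|[set X | nu X == k]|.
Proof.
move=> km; pose l := enum core ++ flat (enum 'I_m).
have ul : uniq l.
  rewrite cat_uniq enum_uniq flat_uniq ?enum_uniq // andbT; apply/hasPn => x xW.
  by rewrite /= mem_enum inE negbK inE.
have lT x : x \in l.
  by rewrite mem_cat mem_enum !inE; case: (x \in flat _).
rewrite -[leqRHS](card_forces [pred X | nu X == k] ul lT).
(* The empty [J] is left out, which costs the [- 1]: its witness is empty, and a subset of the core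
   is a nonmember, already counted in [~: F]. *)
pose Bal := [set J : {set 'I_m} | [&& ballot (enum 'I_m) J,
  count (mem J) (enum 'I_m) <= k & count (mem J) (enum 'I_m) + k <= m]] :\ set0.
pose h (UJ : {set T} * {set 'I_m}) := UJ.1 :|: witness UJ.2.
(* [U] is recovered as the trace on the core, and [J] from the points [b j] that occur. *)
have h_inj : {in setX (powerset core) Bal &, injective h}.
  move=> [U1 J1] [U2 J2] /setXP[/= s1 _] /setXP[/= s2 _] eqh.
  have memh x : (x \in h (U1, J1)) = (x \in h (U2, J2)) by rewrite eqh.
  rewrite !powersetE in s1 s2.
  have coreh U J x : x \in core -> U \subset core -> (x \in h (U, J)) = (x \in U).
    by move=> xc _; rewrite inE orbC /=; case: (boolP (x \in witness J)) => // /witness_core; rewrite xc.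
  have bh U J j : U \subset core -> (b j \in h (U, J)) = (j \in J).
    move=> sU; rewrite inE /= b_witness; case: (boolP (b j \in U)) => // /(subsetP sU)/core_B.
    by move/(_ j); rewrite b_B.
  congr (_, _); apply/setP => x; last by rewrite -(bh _ _ _ s1) memh bh.
  have [xc|xc] := boolP (x \in core); first by rewrite -(coreh _ J1 _ xc s1) memh coreh.
  by rewrite !(contraNF (subsetP _ x) xc).
have dis : [disjoint ~: F & h @: setX (powerset core) Bal].
  rewrite disjoint_sym disjoints_subset setCK; apply/subsetP => X /imsetP[[U J] /setXP[_ /setD1P[J0 _]] ->].
  exact: F_up (witness_member J0) (subsetUr _ _).
have card_h : ('C(m, k) - 1) * 2 ^ #|core| <= #|h @: setX (powerset core) Bal|.
  rewrite card_in_imset // cardsX card_powerset mulnC leq_mul2l; apply/orP; right.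
  rewrite leq_subLR; have := card_ballot (I := 'I_m) k; rewrite !card_ord => /leq_trans; apply.
  by rewrite (cardsD1 set0) leq_add2r; case: (_ \in _).
rewrite -(leq_add2l #|~: F|) in card_h; apply: leq_trans card_h _.
rewrite -cardsUI (disjoint_setI0 dis) cards0 addn0; apply/subset_leq_card.
rewrite subUset; apply/andP; split; apply/subsetP => X.
  by rewrite !inE => XF; apply: forces_nonmember.
case/imsetP=> -[U J] /setXP[/=]; rewrite powersetE => sU; rewrite !inE => /andP[J0 /and3P[bal cJ ckJ]] ->.
exact: forces_witness.
Qed.

Lemma blocks_bound :
  m.+1 * #|~: F| + 2 ^ m * 2 ^ #|core| <= 2 ^ #|T| + m.+1 * 2 ^ #|core|.
Proof.
have cube : \sum_(k < m.+1) #|[set X | nu X == k]| = 2 ^ #|T|.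
  rewrite -cardsT -card_powerset -sum1_card (partition_big (fun X => inord (nu X) : 'I_m.+1) xpredT) //=.
  apply: eq_bigr => k _; rewrite -sum1_card; apply: eq_bigl => X; rewrite !inE subsetT /=.
  by rewrite -(inj_eq val_inj) /= inordK // ltnS nu_leq.
(* For [k <= m] the binomial is positive, so the truncated subtraction is exact. *)
have choose_sum : \sum_(k < m.+1) ('C(m, k) - 1) + m.+1 = 2 ^ m.
  rewrite -[X in _ + X](card_ord m.+1) -sum1_card -big_split /= -[2]/(1 + 1) expnDn.
  apply: eq_bigr => k _; rewrite !exp1n !muln1 subnK // bin_gt0 -ltnS.
  exact: ltn_ord.
have := leq_sum (index_enum _) (fun (k : 'I_m.+1) (_ : true) => card_layer (ltn_ord k : k <= m)).
rewrite cube big_split /= sum_nat_const card_ord -big_distrl /= -choose_sum mulnDl addnA.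
by rewrite leq_add2r.
Qed.

End Blocks.
(** The empty set could be repeated [m.+1] times. Hence every block is nonempty and has a point to
    serve as [b]. *)
Lemma set0_nonmember : set0 \notin F.
Proof.
apply: contra F_free => F0; apply: (@packs_family _ _ _ (fun=> set0)) => [i|i j _].
  by rewrite F0 sub0set.
by rewrite -setI_eq0 set0I.
Qed.

(** The blocks are [m] disjoint members inside [~: Y], so [Y] lies in their core and [2 ^ #|Y|] is
    at most [2 ^ #|core B|]. *)
Lemma nonmember_bound Y : Y \notin F ->
  m.+1 * #|~: F| + (2 ^ m - m.+1) * 2 ^ #|Y| <= 2 ^ #|T|.
Proof.
case/F_sat/packs_blocks=> B [hB B_disj].
have B_F i : B i \in F by have [] := hB i.
have B_ex i : exists x, x \in B i.
  by apply/set0Pn; apply: contraTneq (B_F i) => ->; exact: set0_nonmember.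
have [b b_B] := fin_all_exists B_ex.
have := blocks_bound B_F B_disj b_B.
have sY : Y \subset core B.
  apply/subsetP => x xY; rewrite inE; apply/negP => /mem_W[j _ xj].
  by have [_ /subsetP/(_ _ xj)] := hB j; rewrite inE xY.
have := leq_mul (leqnn (2 ^ m - m.+1)) (leq_pexp2l (isT : 0 < 2) (subset_leq_card sY)).
have : m.+1 <= 2 ^ m by rewrite ltn_expl.
move/subnK => E; have -> : 2 ^ m * 2 ^ #|core B| =
  (2 ^ m - m.+1) * 2 ^ #|core B| + m.+1 * 2 ^ #|core B| by rewrite -mulnDl E.
move: (_ * 2 ^ #|Y|) (_ * 2 ^ #|core B|) (m.+1 * 2 ^ _) (m.+1 * _) (2 ^ #|T|) => a1 a2 a3 a4 a5.
by clear; lia.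
Qed.

End MatchingNumber.

(** * Saturated families *)

Section Saturated.
Variables (n m : nat) (F : {set {set 'I_n}}).
Hypothesis F_saturated : saturated m.+1 F.
Hypothesis m_le_n : m <= n.
Implicit Types X Y : {set 'I_n}.

(** If [Y] were missing, replacing it by the smaller [X] in the matching that it creates would give
    a matching in [F]. *)
Lemma saturated_up X Y : X \in F -> X \subset Y -> Y \in F.
Proof.
move=> XF sXY; have [free sat] := F_saturated.
apply/negPn/negP => /sat[A [hA dA]]; apply: free.
have sub i : (if A i == Y then X else A i) \subset A i by case: eqP => [->|].
exists (fun i => if A i == Y then X else A i); split=> [i|i j ij].
  by have /setU1P[->|AF] := hA i; rewrite ?eqxx //; case: eqP.
exact: disjointWl (sub i) (disjointWr (sub j) (dA i j ij)).
Qed.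

Lemma saturated_free : ~~ packs F m.+1 setT.
Proof.
have [free _] := F_saturated; apply/negP => /packs_blocks[B [hB dB]].
by apply: free; exists B; split=> // i; have [] := hB i.
Qed.

(** The matching created by [X] must use it, and only once since [X] is nonempty; its other [m] sets
    are members inside [~: X]. *)
Lemma saturated_packs_neq0 X : X != set0 -> X \notin F -> packs F m (~: X).
Proof.
have [free sat] := F_saturated; move=> X0 /sat[A [hA dA]].
have [i0 Ai0] : exists i, A i = X.
  have [/existsP[i /eqP]|/existsPn AX] := boolP [exists i, A i == X]; first by exists i.
  case: free; exists A; split=> // i.
  by have /setU1P[/eqP|//] := hA i; rewrite (negPf (AX i)).
have dX i : [disjoint A (lift i0 i) & X] by rewrite -Ai0 dA // eq_sym neq_lift.
apply: (@packs_family _ _ _ (fun i => A (lift i0 i))) => [i|i j ij].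
  rewrite -disjoints_subset dX; split=> //.
  have /setU1P[AX|//] := hA (lift i0 i).
  by have := dX i; rewrite AX -setI_eq0 setIid (negPf X0).
by rewrite dA // (inj_eq lift_inj).
Qed.

(* The matching that saturation provides for the empty set may repeat it, so it
   carries no information; a nonempty nonmember, or the singletons, are used. *)
Lemma saturated_packs X : X \notin F -> packs F m (~: X).
Proof.
have [->|X0 XF] := eqVneq X set0; last exact: saturated_packs_neq0.
move=> _; rewrite setC0.
have [/existsP[Y /andP[Y0 YF]]|/existsPn allF] := boolP [exists Y, (Y != set0) && (Y \notin F)].
  exact: packs_mono (subsetT _) (saturated_packs_neq0 Y0 YF).
apply: (@packs_family _ _ _ (fun i : 'I_m => [set widen_ord m_le_n i])) => [i|i j ij].
  rewrite subsetT; split=> //; have := allF [set widen_ord m_le_n i].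
  by rewrite negb_and !negbK -cards_eq0 cards1.
by rewrite disjoints1 inE; apply: contraNN ij => /eqP/(congr1 val) ij; apply/eqP/val_inj.
Qed.

End Saturated.

(** * Partial binomial sums, the threshold [g], and the final bound *)

Lemma card_small_sets n r :
  #|[set X : {set 'I_n} | #|X| < r]| = \sum_(0 <= i < r) 'C(n, i).
Proof.
elim: r => [|r IH]; first by rewrite big_geq // eq_card0 // => X; rewrite inE.
rewrite big_nat_recr //= -IH -[X in 'C(X, r)](card_ord n) -card_draws.
have disj : [set X : {set 'I_n} | #|X| < r] :&: [set X : {set 'I_n} | #|X| == r] = set0.
  by apply/setP => X; rewrite !inE; case: ltngtP.
rewrite -cardsUI disj cards0 addn0.
by apply: eq_card => X; rewrite !inE ltnS leq_eqVlt orbC.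
Qed.

Local Open Scope ring_scope.

(** A maximum is either attained or the default 0; for 0 the condition reduces to
    [2 ^+ (s - 1) <= 2 ^+ n]. *)
Lemma g_condP n s : (0 < s <= n.+1)%N -> g_cond n s (g n s).
Proof.
case/andP=> s0 sn; apply: (big_ind (fun t => g_cond n s t)) => //.
  rewrite /g_cond big_nat1 bin0 expr0 mulr1 ler_pdivlMr ?ltr0n // mul1r opprB addrA.
  rewrite -[leLHS]add0r addrAC lerD2r subr_ge0.
  by rewrite ler_weXn2l ?ler1n // leq_subLR add1n.
by move=> a b ha hb; rewrite /maxn; case: ifP.
Qed.

Theorem theorem1p3 (n s : nat) (hn : (1 <= n)%N) (hs : (2 <= s <= n + 1)%N)
    (F : {set {set 'I_n}}) (hF : saturated s F) :
  (1 - 1 / s%:R) * 2 ^+ n + (2 ^+ (s - 1)%N / s%:R - 1) * 2 ^+ (g n s)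
    <= (#|F|%:R : rat).
Proof.
have s0 : (0 : rat) < s%:R by rewrite ltr0n; case/andP: hs => /ltnW.
(* This is the claim multiplied by [s] and rewritten for the complement of [F]. *)
suff key : s%:R * #|~: F|%:R + (2 ^+ (s - 1)%N - s%:R) * 2 ^+ (g n s) <= (2 ^+ n : rat).
  have cF : #|F|%:R + #|~: F|%:R = 2 ^+ n :> rat.
    by rewrite -natrD cardsC -cardsT -powersetT card_powerset cardsT card_ord natrX.
  rewrite -(ler_pM2l s0) (_ : #|F|%:R = 2 ^+ n - #|~: F|%:R); last by rewrite -cF addrK.
  rewrite -subr_ge0 in key; rewrite -subr_ge0; apply: le_trans key _.
  have clear_den (S a c e d : rat) : S != 0 ->
      a - (S * d + (c - S) * e) = S * (a - d) - S * ((1 - 1 / S) * a + (c / S - 1) * e).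
    by move=> S0; field.
  by rewrite clear_den // gt_eqF.
have gP : g_cond n s (g n s) by apply: g_condP; case/andP: hs => /ltnW -> /=; rewrite addn1.
case: s hs hF s0 gP => // m /andP[_ mn] hF s0 gP; rewrite addn1 ltnS in mn.
have [/existsP[Y /andP[YF gY]]|/existsPn small] := boolP [exists Y, (Y \notin F) && (g n m.+1 <= #|Y|)%N].
  have := nonmember_bound (saturated_up hF) (saturated_free hF) (saturated_packs hF mn) YF.
  rewrite card_ord; move: gY; move: (g _ _) #|Y| #|~: F| => t y d ty.
  have m_exp : (m.+1 <= 2 ^ m)%N by exact: ltn_expl.
  move=> /(leq_trans (leq_add (leqnn _) (leq_mul (leqnn _) (leq_pexp2l (isT : 0 < 2)%N ty)))).
  by rewrite -(ler_nat rat) natrD !natrM natrB // !natrX subn1.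
(* Here nonmembers have fewer than [g n m.+1] points; the sum includes one further term so as to
   match [g_cond]. *)
have le_small : (#|~: F| <= \sum_(0 <= i < (g n m.+1).+1) 'C(n, i))%N.
  rewrite -card_small_sets; apply/subset_leq_card/subsetP => X; rewrite !inE => XF.
  by have := small X; rewrite XF /= -ltnNge => /ltnW.
move: gP; rewrite /g_cond -natr_sum ler_pdivlMr // lerBrDr mulrC; apply: le_trans.
by rewrite lerD2r ler_wpM2l ?ler0n // ler_nat.
Qed.
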